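(* Let $q>2$ be a prime power. Every nonclassical orthogonal Buekenhout–Metz unital in the Desarguesian plane $\mathrm{PG}(2,q^2)$ contains an O'Nan configuration.
   Context: A unital embedded in a projective plane of order $q^2$ is a set $\mathcal U$ of $q^3+1$ points such that every line meets $\mathcal U$ in exactly $1$ or $q+1$ points. An O'Nan configuration in $\mathcal U$ consists of four distinct lines which pairwise intersect in six distinct points, all six of which lie in $\mathcal U$. Orthogonal Buekenhout–Metz unitals: in the Bruck–Bose model of $\mathrm{PG}(2,q^2)$ (points are the affine points of $\mathrm{PG}(4,q)$ off a hyperplane $\Sigma_\infty$ together with the lines of a regular spread $\mathcal S$ of $\Sigma_\infty$), take an elliptic cone of $\mathrm{PG}(4,q)$ (a cone with vertex a point over an elliptic quadric of a solid) meeting $\Sigma_\infty$ in a line of $\mathcal S$; its points, viewed in $\mathrm{PG}(2,q^2)$, form an orthogonal Buekenhout–Metz unital. Equivalently (for $q>2$), these are exactly the sets projectively equivalent to $\mathcal U_{\alpha,\beta}=\{(x,\alpha x^2+\beta x^{q+1}+r,1): r\in\mathbb F_q,\ x\in\mathbb F_{q^2}\}\cup\{(0,1,0)\}$, where $\alpha,\beta\in\mathbb F_{q^2}$ satisfy: for $q$ odd, $(\beta-\beta^q)^2+4\alpha^{q+1}$ is a nonsquare in $\mathbb F_q$; for $q$ even, $\beta\notin\mathbb F_q$ and $\alpha^{q+1}/(\beta+\beta^q)^2$ has absolute trace $0$. The unital $\mathcal U_{\alpha,\beta}$ is classical (the set of absolute points of a unitary polarity) if and only if $\alpha=0$; nonclassical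 means $\alpha\neq 0$. *)

(* Defs.v *)
From HB Require Import structures.
From mathcomp Require Import all_boot all_order all_algebra all_field.

Set Implicit Arguments.
Unset Strict Implicit.
Unset Printing Implicit Defensive.

Import GRing.Theory.
Local Open Scope ring_scope.

(* PG(V): points, lines and solids are the linear subspaces of V of vector
   dimension 1, 2 and 4; a point set is a predicate on subspaces that holds
   of points only. *)

Definition is_point (k : fieldType) (V : vectType k) (p : {vspace V}) : Prop :=
  \dim p = 1%N.

Definition is_line (k : fieldType) (V : vectType k) (l : {vspace V}) : Prop :=
  \dim l = 2%N.

Definition is_solid (k : fieldType) (V : vectType k) (T : {vspace V}) : Prop :=
  \dim T = 4%N.

Definition polar (k : fieldType) (V : vectType k) (Q : V -> k) (u v : V) : k :=
  Q (u + v) - Q u - Q v.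

(* [polar Q] is symmetric, so linearity in one argument is bilinearity. *)
Definition quadratic_form (k : fieldType) (V : vectType k) (Q : V -> k) : Prop :=
  (forall (a : k) (u : V), Q (a *: u) = a ^+ 2 * Q u) /\
  (forall (a : k) (u u' v : V),
     polar Q (a *: u + u') v = a * polar Q u v + polar Q u' v).

(* The usual notion in all characteristics, including 2. *)
Definition nonsingular_on (k : fieldType) (V : vectType k)
    (T : {vspace V}) (Q : V -> k) : Prop :=
  forall u, u \in T -> Q u = 0 -> (forall v, v \in T -> polar Q u v = 0) -> u = 0.

(* An elliptic quadric of a solid is a nonsingular quadric containing no line.
   Every quadratic form on T extends to V, so Q may be taken on V. *)
Definition elliptic_quadric (k : fieldType) (V : vectType k)
    (T : {vspace V}) (E : {vspace V} -> Prop) : Prop :=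
  is_solid T /\
  exists Q : V -> k,
    [/\ quadratic_form Q,
        nonsingular_on T Q,
        forall p, E p <->
          [/\ is_point p, (p <= T)%VS & forall u, u \in p -> Q u = 0]
      & forall l, is_line l -> (l <= T)%VS ->
          ~ (forall p, is_point p -> (p <= l)%VS -> E p)].

Definition elliptic_cone (k : fieldType) (V : vectType k)
    (C : {vspace V} -> Prop) : Prop :=
  exists (T v : {vspace V}) (E : {vspace V} -> Prop),
    [/\ elliptic_quadric T E,
        is_point v,
        ~ (v <= T)%VS
      & forall p, C p <-> is_point p /\ exists e, E e /\ (p <= v + e)%VS].

(* Bruck--Bose model. For L / K quadratic, with K of order q, the space PG(4,q)
   is PG(L x L x K) over K and Sigma_infty is the hyperplane z = 0. The map
   (x, y, z) |-> (x, y, z) M is K-linear and injective into L^3; M in GL_3(L)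
   selects the line at infinity (the image of Sigma_infty) and the coordinates.
   The preimage of a point p of PG(2,q^2) is a single point of PG(4,q) off
   Sigma_infty if p is affine, and otherwise a line of Sigma_infty; the latter
   lines, i.e. the one-dimensional L-subspaces of L x L, form the regular
   spread. *)

Definition bb_space (K : finFieldType) (L : fieldExtType K) : vectType K :=
  (L * L * K^o)%type.

Definition bb_map (K : finFieldType) (L : fieldExtType K) (M : 'M[L]_3)
    (w : bb_space L) : 'rV[L]_3 :=
  (\row_(i < 3) [:: w.1.1; w.1.2; w.2%:A]`_i) *m M.

Definition at_infinity (K : finFieldType) (L : fieldExtType K)
    (w : bb_space L) : Prop := w.2 = 0.

Definition on_line_at_infinity (K : finFieldType) (L : fieldExtType K)
    (M : 'M[L]_3) (p : {vspace 'rV[L]_3}) : Prop :=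
  forall v, v \in p -> exists w : bb_space L, at_infinity w /\ v = bb_map M w.

Definition meets_infinity_in_spread_line (K : finFieldType) (L : fieldExtType K)
    (M : 'M[L]_3) (C : {vspace bb_space L} -> Prop) : Prop :=
  exists s : {vspace 'rV[L]_3},
    [/\ is_point s,
        on_line_at_infinity M s
      & forall w : bb_space L, w != 0 -> at_infinity w ->
          (C <[w]>%VS <-> bb_map M w \in s)].

(* p belongs to the set when the affine point or the spread line that
   represents p is contained in C. *)
Definition bb_point_set (K : finFieldType) (L : fieldExtType K)
    (M : 'M[L]_3) (C : {vspace bb_space L} -> Prop)
    (p : {vspace 'rV[L]_3}) : Prop :=
  is_point p /\
  forall w : bb_space L, w != 0 -> bb_map M w \in p -> C <[w]>%VS.

Definition orthogonal_BM_unital (K : finFieldType) (L : fieldExtType K)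
    (U : {vspace 'rV[L]_3} -> Prop) : Prop :=
  exists (M : 'M[L]_3) (C : {vspace bb_space L} -> Prop),
    [/\ M \in unitmx,
        elliptic_cone C,
        meets_infinity_in_spread_line M C
      & forall p, U p <-> bb_point_set M C p].

(* A unitary polarity of PG(2,q^2) is p |-> {v | u H v^* = 0 for all u in p},
   with H an invertible Hermitian matrix for the involution x |-> x^q. *)
Definition conj_mx (K : finFieldType) (L : fieldExtType K) (m n : nat)
    (A : 'M[L]_(m, n)) : 'M[L]_(n, m) :=
  (map_mx (fun x : L => x ^+ #|K|) A)^T.

Definition nondegenerate_hermitian (K : finFieldType) (L : fieldExtType K)
    (H : 'M[L]_3) : Prop := H \in unitmx /\ conj_mx H = H.

Definition absolute_point (K : finFieldType) (L : fieldExtType K)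
    (H : 'M[L]_3) (p : {vspace 'rV[L]_3}) : Prop :=
  is_point p /\
  forall u v, u \in p -> v \in p -> u *m H *m conj_mx v = 0.

Definition classical_unital (K : finFieldType) (L : fieldExtType K)
    (U : {vspace 'rV[L]_3} -> Prop) : Prop :=
  exists H : 'M[L]_3,
    nondegenerate_hermitian H /\ forall p, U p <-> absolute_point H p.

Definition ONan_configuration (k : fieldType)
    (U : {vspace 'rV[k]_3} -> Prop) (l : 'I_4 -> {vspace 'rV[k]_3}) : Prop :=
  [/\ forall i, is_line (l i),
      injective l,
      forall i j i' j' : 'I_4, (i < j)%N -> (i' < j')%N ->
        (l i :&: l j = l i' :&: l j')%VS -> (i, j) = (i', j')
    & forall i j : 'I_4, (i < j)%N ->
        is_point (l i :&: l j)%VS /\ U (l i :&: l j)%VS].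

(* Main.v *)
Require Import Defs.
From HB Require Import structures.
From mathcomp Require Import all_boot all_order all_algebra all_field.
From mathcomp Require Import ring zify.

Set Implicit Arguments.
Unset Strict Implicit.
Unset Printing Implicit Defensive.

Import GRing.Theory.
Local Open Scope ring_scope.

(** In suitable coordinates the cone has the equation G(x) + z Tr(y) = 0, its
    vertex lying on the spread line because an elliptic quadric contains no
    line.  The affine points of the unital are then the (x, y) with
    G(x) + Tr(y) = 0, where G(x) = Tr(a x^2) + b N(x) is anisotropic over K; for
    a = 0 this is a Hermitian curve.

    For a <> 0 the configuration consists of two lines through (0, 0) and two
    lines through (0, c), where Tr(c) = 0, paired by an involution of the unital.
    For q odd the involution is (x, y) |-> (-x, y), and all conditions reduce to
    finding x, y with G(x)/N(x) = - G(y)/N(y), which exist by counting.  For q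
    even it is a Baer involution, and the conditions have an explicit solution
    for each element of K other than 0 and 1, whence q > 2. *)

(** * Quadratic forms and their polar forms *)

Section QuadraticForm.

Variables (k : fieldType) (V : vectType k) (Q : V -> k).

Lemma polarC u v : polar Q u v = polar Q v u.
Proof. by rewrite /polar [u + v]addrC addrAC. Qed.

Lemma quadD u v : Q (u + v) = Q u + Q v + polar Q u v.
Proof. by rewrite /polar; ring. Qed.

Hypothesis qQ : quadratic_form Q.

Lemma quadZ c u : Q (c *: u) = c ^+ 2 * Q u.
Proof. by case: qQ. Qed.

Lemma quad0 : Q 0 = 0.
Proof. by rewrite -(scale0r 0) quadZ expr0n mul0r. Qed.

Lemma polar0l v : polar Q 0 v = 0.
Proof. by rewrite /polar add0r quad0 subr0 subrr. Qed.

Lemma polarZl c u v : polar Q (c *: u) v = c * polar Q u v.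
Proof. by case: qQ => _ lin; rewrite -[c *: u]addr0 lin polar0l addr0. Qed.

Lemma polarDl u u' v : polar Q (u + u') v = polar Q u v + polar Q u' v.
Proof. by case: qQ => _ lin; rewrite -[u]scale1r lin scale1r mul1r. Qed.

End QuadraticForm.

(** * Conjugation in the quadratic extension L of K, and forms on L written with traces and norms *)

Section Frobenius.

Variables (K : finFieldType) (L : fieldExtType K).

Lemma algD (c d : K) : (c + d)%:A = c%:A + d%:A :> L.
Proof. exact: scalerDl. Qed.

Lemma algM (c d : K) : (c * d)%:A = c%:A * d%:A :> L.
Proof. by rewrite mulr_algl scalerA. Qed.

Lemma algX (c : K) n : (c ^+ n)%:A = c%:A ^+ n :> L.
Proof. by rewrite exprZn expr1n. Qed.

(** For L of degree 2 this is the nontrivial automorphism of L over K, with trace Tr(x) = x + frob x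
    and norm N(x) = x frob x; [conj_mx] is the conjugate transpose for it. *)
Definition frob (x : L) : L := x ^+ #|K|.

Fact frob_is_zmod_morphism : zmod_morphism frob.
Proof.
have [p p_pr pK] := finPcharP K.
have pnat : [pchar L].-nat #|K|.
  have pL : p \in [pchar L] by rewrite pchar_lalg.
  by rewrite (eq_pnat _ (pcharf_eq pL)) (card_pprimeChar pK) pnatX pnat_id.
move=> x y; apply/eqP; rewrite eq_sym subr_eq /frob -exprDn_pchar //.
by rewrite subrK.
Qed.

Fact frob_is_monoid_morphism : monoid_morphism frob.
Proof. by split=> [|x y]; rewrite /frob ?expr1n ?exprMn. Qed.

HB.instance Definition _ :=
  GRing.isZmodMorphism.Build L L frob frob_is_zmod_morphism.
HB.instance Definition _ :=
  GRing.isMonoidMorphism.Build L L frob frob_is_monoid_morphism.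

Lemma frob_scalarP (x : L) : reflect (exists c : K, x = c%:A) (frob x == x).
Proof.
have := Fermat's_little_theorem 1%AS x; rewrite dimv1 expn1 /frob => <-.
exact: vlineP.
Qed.

Lemma frob_scalar (c : K) : frob c%:A = c%:A.
Proof. by apply/eqP/frob_scalarP; exists c. Qed.

Hypothesis dimL : \dim {:L} = 2%N.

Lemma frobK : involutive frob.
Proof.
move=> x; have := Fermat's_little_theorem {:L}%AS x.
by rewrite memvf dimL expnS expn1 exprM => /esym/eqP.
Qed.

Lemma frobM : {morph frob : x y / x * y}.
Proof. exact: rmorphM. Qed.

Lemma frobD : {morph frob : x y / x + y}.
Proof. exact: rmorphD. Qed.

Lemma frobN : {morph frob : x / - x}.
Proof. exact: rmorphN. Qed.

Lemma frobV : {morph frob : x / x^-1}.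
Proof. exact: fmorphV. Qed.

Lemma frobMn n : {morph frob : x / x *+ n}.
Proof. exact: rmorphMn. Qed.

Lemma frobX n : {morph frob : x / x ^+ n}.
Proof. exact: rmorphXn. Qed.

Definition frobE :=
  (frobK, frob_scalar, frobM, frobD, frobN, frobV, frobMn, frobX).

Lemma exists_nonscalar : exists t : L, frob t != t.
Proof.
have /subvPn [t _ t1] : ~~ ({:L} <= 1)%VS.
  by apply/negP => /dimvS; rewrite dimL dimv1.
exists t; apply: contra t1 => /frob_scalarP [c ->].
by rewrite rpredZ // mem1v.
Qed.

(** Cramer's rule for x = c1 t + c0 and its conjugate; both quotients are fixed by [frob], hence lie
    in K. *)
Lemma frob_coord (t x : L) : frob t != t ->
  exists c0 c1 : K, [/\ c0%:A = (t * frob x - frob t * x) / (t - frob t),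
    c1%:A = (x - frob x) / (t - frob t) & x = c1 *: t + c0%:A].
Proof.
move=> nt; have d0 : t - frob t != 0 by rewrite subr_eq0 eq_sym.
have d1 : frob t - t != 0 by rewrite subr_eq0.
have /frob_scalarP [c0 e0] :
    frob ((t * frob x - frob t * x) / (t - frob t))
      == (t * frob x - frob t * x) / (t - frob t).
  by apply/eqP; rewrite !frobE; field; apply/andP.
have /frob_scalarP [c1 e1] :
    frob ((x - frob x) / (t - frob t)) == (x - frob x) / (t - frob t).
  by apply/eqP; rewrite !frobE; field; apply/andP.
exists c0, c1; split=> //.
by rewrite -e0 -[c1 *: t]mulr_algl -e1; field.
Qed.

Lemma trace_surj (c : K) : exists g : L, g + frob g = c%:A.
Proof.
have [t nt] := exists_nonscalar.
have d0 : t - frob t != 0 by rewrite subr_eq0 eq_sym.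
have d1 : frob t - t != 0 by rewrite subr_eq0.
exists (- c%:A * frob t / (t - frob t)); rewrite !frobE.
by field; apply/andP.
Qed.

(** Nondegeneracy of the trace form, made explicit: [eta] is solved from h 1 = Tr(eta) and h t =
    Tr(eta t). *)
Lemma linear_functional_trace (h : L -> K) :
    (forall c u v, h (c *: u + v) = c * h u + h v) ->
  exists eta, forall x, (h x)%:A = eta * x + frob (eta * x).
Proof.
move=> lin; have [t nt] := exists_nonscalar.
have d0 : t - frob t != 0 by rewrite subr_eq0 eq_sym.
have d1 : frob t - t != 0 by rewrite subr_eq0.
exists (((h t)%:A - (h 1)%:A * frob t) / (t - frob t)) => x.
have [c0 [c1 [e0 e1 ex]]] := frob_coord x nt.
have h0 : h 0 = 0.
  by apply: (addrI (h 0)); rewrite -{1}[h 0]mul1r -lin scaler0 !addr0.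
have -> : h x = c1 * h t + c0 * h 1.
  by rewrite ex lin -[c0%:A]addr0 lin h0 addr0.
rewrite algD !algM e0 e1 !frobE.
by field; apply/andP.
Qed.

(** The values of Q at 1 and t and of its polar form at (t, 1) determine Q. Equating them with those
    of Tr(a x^2) + b N(x) gives a linear system in a, frob a and b; its solution involves no
    division by 2, so it serves every characteristic. *)
Lemma quadratic_form_trace_norm (Q : L -> K) : quadratic_form Q ->
  exists a b, frob b = b /\
    forall x, (Q x)%:A = a * x ^+ 2 + frob (a * x ^+ 2) + b * (x * frob x).
Proof.
move=> qQ; have [t nt] := exists_nonscalar.
have d0 : t - frob t != 0 by rewrite subr_eq0 eq_sym.
have d1 : frob t - t != 0 by rewrite subr_eq0.
set A := (Q 1)%:A : L; set B := (polar Q t 1)%:A : L; set D := (Q t)%:A : L.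
have [fA fB fD] : [/\ frob A = A, frob B = B & frob D = D].
  by split; apply: frob_scalar.
exists ((A * frob t ^+ 2 - B * frob t + D) / (t - frob t) ^+ 2).
exists ((B * (t + frob t) - A * t * frob t *+ 2 - D *+ 2) / (t - frob t) ^+ 2).
split=> [|x].
  by rewrite !(fA, fB, fD, frobE); field; apply/andP.
have [c0 [c1 [e0 e1 ex]]] := frob_coord x nt.
have -> : Q x = c1 ^+ 2 * Q t + c1 * (c0 * polar Q t 1) + c0 ^+ 2 * Q 1.
  have p1 : polar Q c0%:A t = c0 * polar Q t 1.
    by rewrite [polar Q t 1]polarC; apply: polarZl.
  rewrite ex quadD !(quadZ qQ) (polarZl qQ) [polar Q t _]polarC p1.
  exact: addrAC.
rewrite 2!algD !(algX, algM) -/A -/B -/D e0 e1 !(fA, fB, fD, frobE).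
by field; apply/andP.
Qed.

End Frobenius.

(** * Affine points and lines of the plane in the coordinates given by [N] *)

Section PlaneCoordinates.

Variables (k : fieldType) (N : 'M[k]_3).

(** Written like the row inside [bb_map], so that [bb_map] is a [vec3] by conversion. *)
Definition vec3 (x y z : k) : 'rV[k]_3 := \row_(i < 3) [:: x; y; z]`_i.

Lemma vec3_surj (v : 'rV[k]_3) : exists x y z, v = vec3 x y z.
Proof.
exists (v 0 0), (v 0 1), (v 0 (inord 2)); apply/rowP => i; rewrite mxE.
case: i => [[|[|[|//]]] lti] /=; congr (v 0 _); apply: val_inj => //=.
by rewrite inordK.
Qed.

Lemma vec3_inj x y z x' y' z' :
  vec3 x y z = vec3 x' y' z' -> [/\ x = x', y = y' & z = z'].
Proof.
move=> /rowP e; split.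
- by have := e 0; rewrite !mxE.
- by have := e 1; rewrite !mxE.
- by have := e (inord 2); rewrite !mxE inordK.
Qed.

Lemma vec3D x y z x' y' z' :
  vec3 x y z + vec3 x' y' z' = vec3 (x + x') (y + y') (z + z').
Proof. by apply/rowP=> i; rewrite !mxE; case: i => [[|[|[|//]]] ?]. Qed.

Lemma vec3Z c x y z : c *: vec3 x y z = vec3 (c * x) (c * y) (c * z).
Proof. by apply/rowP=> i; rewrite !mxE; case: i => [[|[|[|//]]] ?]. Qed.

Lemma vec3_0 : vec3 0 0 0 = 0.
Proof. by apply/rowP=> i; rewrite !mxE; case: i => [[|[|[|//]]] ?]. Qed.

Hypothesis N_unit : N \in unitmx.

Lemma vec3_coord (v : 'rV[k]_3) : exists x y z, v = vec3 x y z *m N.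
Proof.
have [x [y [z e]]] := vec3_surj (v *m invmx N).
by exists x, y, z; rewrite -e mulmxKV.
Qed.

Lemma vec3_mulmx_inj x y z x' y' z' :
  vec3 x y z *m N = vec3 x' y' z' *m N -> [/\ x = x', y = y' & z = z'].
Proof. by move/(can_inj (mulmxK N_unit)); apply: vec3_inj. Qed.

Lemma vec3_mulmx_eq0 x y z :
  (vec3 x y z *m N == 0) = [&& x == 0, y == 0 & z == 0].
Proof.
apply/eqP/and3P => [|[/eqP-> /eqP-> /eqP->]]; last by rewrite vec3_0 mul0mx.
by rewrite -(mul0mx _ N) -vec3_0 => /vec3_mulmx_inj[-> -> ->]; rewrite eqxx.
Qed.

Definition apoint (x y : k) : {vspace 'rV[k]_3} := <[vec3 x y 1 *m N]>%VS.

(** The line Y = m X + c Z, spanned by its point at infinity and its point on X = 0. *)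
Definition aline (m c : k) : {vspace 'rV[k]_3} :=
  (<[vec3 1 m 0 *m N]> + <[vec3 0 c 1 *m N]>)%VS.

Lemma mem_apoint X Y Z x y :
  (vec3 X Y Z *m N \in apoint x y) = (X == Z * x) && (Y == Z * y).
Proof.
apply/vlineP/andP => [[c]|[/eqP-> /eqP->]].
  by rewrite scalemxAl vec3Z mulr1 => /vec3_mulmx_inj[-> -> ->]; rewrite !eqxx.
by exists Z; rewrite scalemxAl vec3Z mulr1.
Qed.

Lemma mem_aline X Y Z m c :
  (vec3 X Y Z *m N \in aline m c) = (Y == m * X + c * Z).
Proof.
apply/memv_addP/eqP => [[_ /vlineP[a ->] [_ /vlineP[b ->]]]|->].
  rewrite !scalemxAl -mulmxDl !vec3Z vec3D => /vec3_mulmx_inj[-> -> ->].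
  by ring.
exists (X *: (vec3 1 m 0 *m N)); first exact/memvZ/memv_line.
exists (Z *: (vec3 0 c 1 *m N)); first exact/memvZ/memv_line.
rewrite !scalemxAl -mulmxDl !vec3Z vec3D; congr (vec3 _ _ _ *m N); ring.
Qed.

Lemma apoint_is_point x y : is_point (apoint x y).
Proof. by rewrite /is_point dim_vline vec3_mulmx_eq0 oner_eq0 !andbF. Qed.

Lemma aline_is_line m c : is_line (aline m c).
Proof.
rewrite /is_line /aline dimv_disjoint_sum.
  by rewrite !dim_vline !vec3_mulmx_eq0 oner_eq0 !andbF.
apply/eqP; rewrite -subv0; apply/subvP => v.
rewrite memv_cap memv0 => /andP[/vlineP[a ->] /vlineP[b]].
rewrite !scalemxAl !vec3Z => /vec3_mulmx_inj[ea _ _].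
by move: ea; rewrite mulr1 mulr0 => ->; rewrite !mul0r vec3_0 mul0mx.
Qed.

Lemma aline_cap m c m' c' : m != m' ->
  (aline m c :&: aline m' c')%VS
    = apoint ((c' - c) / (m - m')) (m * ((c' - c) / (m - m')) + c).
Proof.
rewrite -subr_eq0 => d0; apply/vspaceP => v.
have [X [Y [Z ->]]] := vec3_coord v; rewrite memv_cap !mem_aline mem_apoint.
apply/andP/andP => [[/eqP-> /eqP e]|[/eqP-> /eqP->]].
  have -> : X = Z * ((c' - c) / (m - m')).
    apply: (mulfI d0); transitivity ((m * X + c * Z) - m' * X - c * Z); first ring.
    by rewrite e; field.
  by split; apply/eqP; field.
by split; apply/eqP; field.
Qed.

Lemma two_pencils_ONan (U : {vspace 'rV[k]_3} -> Prop) (s : 'I_4 -> k) (c : k) :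
    injective s -> c != 0 ->
    U (apoint 0 0) -> U (apoint 0 c) ->
    (forall i j : 'I_4, (i < 2)%N -> (2 <= j)%N ->
      U (apoint (c / (s i - s j)) (s i * (c / (s i - s j))))) ->
  exists l, ONan_configuration U l.
Proof.
move=> s_inj c0 U0 Uc Us; pose d (i : 'I_4) := if (i < 2)%N then 0 else c.
have s_neq (i j : 'I_4) : i != j -> s i != s j by rewrite (inj_eq s_inj).
have no3 (i j l : 'I_4) X Y : i != j -> i != l -> j != l ->
    Y = s i * X + d i -> Y = s j * X + d j -> Y = s l * X + d l -> False.
  (* Two lines of one pencil meet on X = 0, where the third line has the same intercept only if it
     belongs to that pencil too; a pencil has just two lines. *)
  have same (a b e : 'I_4) : a != b -> a != e -> b != e ->
      (a < 2)%N = (b < 2)%N ->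
      Y = s a * X + d a -> Y = s b * X + d b -> Y = s e * X + d e -> False.
    move=> ab ae be sab ea eb ee.
    have X0 : X = 0.
      have : (s a - s b) * X = 0.
        have dd : d a = d b by rewrite /d sab.
        transitivity ((s a * X + d a) - s b * X - d b); first by rewrite dd; ring.
        by rewrite -ea eb; ring.
      by move/eqP; rewrite mulf_eq0 subr_eq0 (negPf (s_neq _ _ ab)) => /eqP.
    have de : d a = d e by move: ea ee; rewrite X0 !mulr0 !add0r => <-.
    have : (a < 2)%N = (e < 2)%N.
      move: de; rewrite /d; case: ifP; case: ifP => // _ _ /eqP.
        by rewrite eq_sym (negPf c0).
      by rewrite (negPf c0).
    move: ab ae be sab (ltn_ord a) (ltn_ord b) (ltn_ord e).
    by rewrite -!val_eqE /=; lia.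
  (* Among three lines two belong to the same pencil; [same] is applied to them. *)
  move=> ij il jl ei ej el.
  have [|] := eqVneq (i < 2)%N (j < 2)%N; first by move/same; apply; eassumption.
  have [|h1 h2] := eqVneq (i < 2)%N (l < 2)%N.
    by move/same=> h _; apply: (h j) => //; rewrite eq_sym.
  have /same h : (j < 2)%N = (l < 2)%N by move: h1 h2; do 3!case: (_ < 2)%N.
  by apply: (h i) => //; rewrite eq_sym.
pose x i j := (d j - d i) / (s i - s j).
have cap (i j : 'I_4) : (i < j)%N ->
    (aline (s i) (d i) :&: aline (s j) (d j))%VS
      = apoint (x i j) (s i * x i j + d i).
  by move=> ij; apply: aline_cap; apply: s_neq; rewrite -val_eqE ltn_eqF.
exists (fun i => aline (s i) (d i)); split=> [i|i j|i j i' j' ij ij'|i j ij].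
- exact: aline_is_line.
- move=> /vspaceP/(_ (vec3 1 (s i) 0 *m N));
  rewrite !mem_aline !mulr0 !addr0 !mulr1.
  by rewrite eqxx => /esym/eqP/s_inj.
- move=> e; have P := memv_line (vec3 (x i j) (s i * x i j + d i) 1 *m N).
  have : vec3 (x i j) (s i * x i j + d i) 1 *m N
           \in (aline (s i') (d i') :&: aline (s j') (d j'))%VS.
    by rewrite -e cap.
  rewrite memv_cap !mem_aline !mulr1 => /andP[/eqP ei' /eqP ej'].
  have : vec3 (x i j) (s i * x i j + d i) 1 *m N
           \in (aline (s i) (d i) :&: aline (s j) (d j))%VS.
    by rewrite cap.
  rewrite memv_cap !mem_aline !mulr1 => /andP[_ /eqP ej].
  have nij : i != j by rewrite -val_eqE ltn_eqF.
  (* By [no3], a line of the configuration through the point of lines i and j is one of these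
     two. *)
  have mem (a : 'I_4) : s i * x i j + d i = s a * x i j + d a ->
      (i == a) || (j == a).
    move=> ea; apply/norP => -[ia ja].
    exact: (no3 i j a (x i j) _ nij ia ja erefl ej ea).
  move: (mem _ ei') (mem _ ej') => /orP h1 /orP h2.
  have [? ?] : val i = val i' /\ val j = val j'.
    by case: h1 h2 => [|] /eqP h1 [|] /eqP h2; subst; move: ij ij'; lia.
  by congr pair; apply: val_inj.
- rewrite cap //; split; first exact: apoint_is_point.
  rewrite /x /d; case: (ltnP i 2) => i2; case: (ltnP j 2) => j2.
  + by rewrite subrr mul0r mulr0 addr0.
  + by rewrite subr0 addr0; apply: Us.
  + by move: ij i2 j2; lia.
  + by rewrite subrr mul0r mulr0 add0r.
Qed.

End PlaneCoordinates.

(** * Slopes of the four lines, in odd and in even characteristic *)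

Section Configuration.

Variables (K : finFieldType) (L : fieldExtType K).
Hypothesis dimL : \dim {:L} = 2%N.

Let frobE := (frobE dimL).

(* The general K-quadratic form on L: Tr(a x^2) + b N(x), for b in K. *)
Definition tnform (a b x : L) : L :=
  a * x ^+ 2 + frob (a * x ^+ 2) + b * (x * frob x).

Variables a b : L.
Hypothesis frob_b : frob b = b.

Let G := tnform a b.

Lemma frob_tnform x : frob (G x) = G x.
Proof. by rewrite /G /tnform !(frob_b, frobE); ring. Qed.

(** The condition on c is the vanishing of a polynomial of degree at most 2, which is nonzero
    because for a != 0 the form is not a multiple of the norm. *)
Lemma tnform_eq_norm_card t (v : K) : a != 0 -> frob t != t ->
  (#|[set c : K | (G (c%:A + t) == v%:A * ((c%:A + t) * frob (c%:A + t)))%R]|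
    <= 2)%N.
Proof.
move=> a0 nt; set S := [set c | _]; pose d := b - v%:A.
pose p := Poly [:: a * t ^+ 2 + frob a * frob t ^+ 2 + d * (t * frob t);
  (a * t + frob a * frob t) *+ 2 + d * (t + frob t); a + frob a + d].
have p0 : p != 0.
  apply/eqP => p0; have pi i : p`_i = 0 by rewrite p0 coef0.
  (* [e2] gives d = -(a + frob a), which turns [e1] into (a - frob a)(t - frob t) = 0; with frob a =
     a, [e0] becomes a (t - frob t)^2 = 0. *)
  move: (pi 0%N) (pi 1%N) (pi 2%N); rewrite !coef_Poly /= => e0 e1 e2.
  have ed : d = - (a + frob a) by apply/eqP; rewrite -addr_eq0 addrC e2.
  have d0 : t - frob t != 0 by rewrite subr_eq0 eq_sym.
  have ea : a - frob a = 0.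
    by apply: (mulIf d0); rewrite mul0r -e1 ed; ring.
  have : a * (t - frob t) ^+ 2 = 0.
    rewrite -e0 ed; have -> : frob a = a by apply/esym/eqP; rewrite -subr_eq0 ea.
    by ring.
  by move/eqP; rewrite mulf_eq0 expf_eq0 (negPf a0) (negPf d0).
have u : uniq [seq c%:A : L | c <- enum S].
  rewrite map_inj_uniq ?enum_uniq // => c c' /eqP.
  by rewrite -subr_eq0 -scalerBl scaler_eq0 oner_eq0 orbF subr_eq0 => /eqP.
have r : all (root p) [seq c%:A : L | c <- enum S].
  apply/allP => _ /mapP [c cS ->]; move: cS; rewrite mem_enum inE => /eqP e.
  apply/eqP; rewrite horner_Poly /=.
  rewrite -[RHS](subrr (G (c%:A + t))) {2}e /G /tnform !frobE /d; ring.
have := max_poly_roots p0 r u; rewrite size_map -cardE => h.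
by rewrite -ltnS; apply: leq_trans h (size_Poly _).
Qed.

(* As [c] runs over K, the ratio tnform / norm takes [#|K|] values at
   [c%:A + t], all in K^*, and each one at most twice.  So its image has more
   than half the size of K^* and meets its own negative. *)
Lemma opposite_tnform_ratio : a != 0 -> (2 : L) != 0 ->
    (forall x, G x = 0 -> x = 0) ->
  exists x y, x * frob y - y * frob x != 0 /\
    G x * (y * frob y) + G y * (x * frob x) = 0.
Proof.
move=> a0 two0 aniso; have [t nt] := exists_nonscalar dimL.
have xs0 (c : K) : c%:A + t != 0.
  apply: contra nt; rewrite addrC addr_eq0 => /eqP ->.
  by rewrite !frobE.
pose P (c v : K) := G (c%:A + t) == v%:A * ((c%:A + t) * frob (c%:A + t)).
have [f fP] : exists f : K -> K, forall c, P c (f c).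
  apply: (fin_all_exists (P := fun c v => is_true (P c v))) => c.
  have n0 : (c%:A + t) * frob (c%:A + t) != 0 by rewrite mulf_neq0 // fmorph_eq0.
  have /frob_scalarP [v ev] :
      frob (G (c%:A + t) / ((c%:A + t) * frob (c%:A + t)))
        == G (c%:A + t) / ((c%:A + t) * frob (c%:A + t)).
    by rewrite frobM // frob_tnform frobV frobM frobK // [frob _ * _]mulrC.
  by exists v; rewrite /P -ev divfK.
have f0 c : f c != 0.
  apply/negP => /eqP e; move: (fP c); rewrite /P e scale0r mul0r => /eqP/aniso/eqP.
  by apply/negP.
have fib v : (#|[set c | f c == v]| <= 2)%N.
  apply: leq_trans (tnform_eq_norm_card v a0 nt); apply/subset_leq_card/subsetP => c.
  by rewrite !inE => /eqP <-; apply: fP.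
pose A := f @: [set: K]; pose B : {set K} := -%R @: A.
have cA : (#|K| <= #|A| * 2)%N.
  rewrite -cardsT -sum1_card (partition_big_imset f) /= -sum_nat_const.
  apply: leq_sum => v _; rewrite sum1dep_card; apply: leq_trans (fib v).
  by apply/subset_leq_card/subsetP => c; rewrite !inE.
have cB : #|B| = #|A| by apply: card_imset; apply: oppr_inj.
have [/eqP AB0|] := boolP (A :&: B == set0).
  have : (#|A :|: B| <= #|[set~ (0 : K)%R]|)%N.
    apply/subset_leq_card/subsetP => v; rewrite !inE => /orP[/imsetP[c _ ->] //|].
    by case/imsetP=> _ /imsetP[c _ ->] ->; rewrite oppr_eq0.
  rewrite cardsU AB0 cards0 subn0 cB cardsC1.
  have K0 : (0 < #|K|)%N by apply/card_gt0P; exists 0.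
  move: cA K0; move: (#|A|) (#|K|) => n m; lia.
case/set0Pn=> v; rewrite inE.
case/andP=> [/imsetP[c _ ec] /imsetP[_ /imsetP[d _ ->] ed]].
have e : f c = - f d by rewrite -ec.
exists (c%:A + t), (d%:A + t); split.
  have -> : (c%:A + t) * frob (d%:A + t) - (d%:A + t) * frob (c%:A + t)
      = (c - d)%:A * (frob t - t) by rewrite scalerBl !frobE; ring.
  rewrite mulf_neq0 // ?subr_eq0 // -in_algE fmorph_eq0 subr_eq0.
  apply/negP => /eqP cd; move: e; rewrite cd => /eqP; rewrite -addr_eq0.
  rewrite -mulr2n -mulr_natl mulf_eq0 (negPf (f0 d)) orbF.
  by rewrite -(fmorph_eq0 (in_alg L)) rmorph_nat (negPf two0).
move: (fP c) (fP d); rewrite /P e => /eqP -> /eqP ->; rewrite scaleNr; ring.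
Qed.

(** Two conditions remain by symmetry, at first coordinates x and y on the line of slope m. As Tr(m
    x) = c (x frob y - y frob x) / (2 N(y)), the first determines c; the second then says that
    G(x)/N(x) and G(y)/N(y) are opposite. *)
Lemma odd_configuration : a != 0 -> (2 : L) != 0 ->
    (forall x, G x = 0 -> x = 0) ->
  exists (s : 'I_4 -> L) c, [/\ injective s, c != 0, c + frob c = 0 &
    forall i j : 'I_4, (i < 2)%N -> (2 <= j)%N ->
      let x := c / (s i - s j) in G x + (s i * x + frob (s i * x)) = 0].
Proof.
move=> a0 two0 aniso.
have [x [y [D0 Exy]]] := opposite_tnform_ratio a0 two0 aniso.
have x0 : x != 0 by apply: contraNneq D0 => ->; rewrite rmorph0 mul0r mulr0 subrr.
have y0 : y != 0 by apply: contraNneq D0 => ->; rewrite rmorph0 mul0r mulr0 subrr.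
have fx0 : frob x != 0 by rewrite fmorph_eq0.
have fy0 : frob y != 0 by rewrite fmorph_eq0.
have Gx0 : G x != 0 by apply: contra x0 => /eqP/aniso->.
have xDy0 : x + y != 0.
  apply: contraNneq D0 => /eqP; rewrite addr_eq0 => /eqP ->.
  by rewrite frobN; apply/eqP; ring.
have xBy0 : x - y != 0.
  by apply: contraNneq D0 => /eqP; rewrite subr_eq0 => /eqP ->; rewrite subrr.
(* The slopes are m, -m, n, -n with m - n = c / x and m + n = c / y, so that
   the configuration is invariant under (x, y) |-> (-x, y). *)
pose c := - (2 * G x * (y * frob y) / (x * frob y - y * frob x)).
have fG := frob_tnform; have f2 : frob (2 : L) = 2 by apply: rmorph_nat.
have c0 : c != 0 by rewrite oppr_eq0 !mulf_neq0 // invr_eq0.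
have fc : frob c = - c.
  rewrite /c; move: (G x) (fG x) => g fg; rewrite !(f2, fg, frobE).
  by field; rewrite D0 -opprB oppr_eq0 mulrC [_ * y]mulrC.
pose m := c * (x + y) / (2 * (x * y)).
pose n := c * (x - y) / (2 * (x * y)).
have mE : frob m = - c * (frob x + frob y) / (2 * (frob x * frob y)).
  by rewrite /m !(f2, fc, frobE).
have mBn : m - n = c / x by rewrite /m /n; field; rewrite x0 y0.
have mDn : m + n = c / y by rewrite /m /n; field; rewrite x0 y0.
have d0 : x * y != 0 by rewrite mulf_neq0.
have Px : G x + (m * x + frob (m * x)) = 0.
  rewrite frobM mE /m /c; move: (G x) => g; field.
  by rewrite D0 x0 y0 fx0 fy0 two0.
have Py : G y + (m * y + frob (m * y)) = 0.
  have -> : G y = - (G x * (y * frob y)) / (x * frob x).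
    apply: (mulIf (mulf_neq0 x0 fx0)); rewrite divfK ?mulf_neq0 //.
    by apply/eqP; rewrite -addr_eq0 addrC Exy.
  rewrite frobM mE /m /c; move: (G x) => g; field.
  by rewrite D0 x0 y0 fx0 fy0 two0.
(* Since G is even, the points on the line of slope -m follow from [Px] and [Py]. *)
have GN z : G (- z) = G z by rewrite /G /tnform frobN !sqrrN mulrNN.
have uniq_s : uniq [:: m; - m; n; - n].
  have neqN (z : L) : z != 0 -> z != - z.
    by move=> z0; rewrite -addr_eq0 -mulr2n -mulr_natl mulf_neq0.
  have m0 : m != 0 by rewrite !mulf_neq0 // invr_eq0 mulf_neq0.
  have n0 : n != 0 by rewrite !mulf_neq0 // invr_eq0 mulf_neq0.
  have mn : m != n by rewrite -subr_eq0 mBn mulf_neq0 // invr_eq0.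
  have mNn : m != - n by rewrite -addr_eq0 mDn mulf_neq0 // invr_eq0.
  rewrite /= !inE !negb_or mn mNn (inj_eq oppr_inj) mn !neqN //.
  by rewrite eqr_oppLR mNn.
have cVV z : c / (c / z) = z by rewrite invfM invrK mulrA divff // mul1r.
exists (fun i => [:: m; - m; n; - n]`_i), c; split=> //.
- by move=> i j /eqP; rewrite nth_uniq ?size_tuple // => /eqP/val_inj.
- by rewrite fc subrr.
case=> [[|[|//]] ?] [[|[|[|[|//]]]] ?] _ //= _.
- by rewrite mBn cVV.
- by rewrite opprK mDn cVV.
- by rewrite -opprD mDn invrN mulrN cVV GN mulrNN.
- by rewrite -opprD mBn invrN mulrN cVV GN mulrNN.
Qed.

(** The two remaining equations read m = k (b' + A / N(w)) + (E + 1) w and the same with v for w.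
    Since v = w + E and N(w) + N(v) = E^2 + E, they agree exactly when k = N(w) N(v) / A. *)
Lemma even_configuration : a != 0 -> (2 : L) = 0 -> (2 < #|K|)%N ->
  exists (s : 'I_4 -> L) c, [/\ injective s, c != 0, c + frob c = 0 &
    forall i j : 'I_4, (i < 2)%N -> (2 <= j)%N ->
      let x := c / (s i - s j) in G x + (s i * x + frob (s i * x)) = 0].
Proof.
move=> a0 two0 K2.
have oppE (x : L) : - x = x.
  by apply/esym/eqP; rewrite -addr_eq0 -mulr2n -mulr_natl two0 mul0r.
have [r r2] : exists r, r ^+ 2 = a.
  have pK : 2%N \in [pchar K].
    by rewrite -(pchar_lalg L) inE /= two0 eqxx.
  (* The exponent is q^2 / 2, and a^(q^2) = a. *)
  have cK := card_pprimeChar pK; exists (a ^+ (#|K| * 2 ^ (logn 2 #|K|).-1)).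
  rewrite -exprM -mulnA -expnSr prednK ?lt0n; last first.
    by apply: contraTneq K2 => e; rewrite cK e.
  by rewrite -cK exprM; apply: (frobK dimL).
have [w fw] : exists w : L, frob w = w + 1.
  have [t nt] := exists_nonscalar dimL.
  have t0 : t + frob t != 0 by rewrite addr_eq0 oppE eq_sym.
  exists (t / (t + frob t)); rewrite !frobE [frob t + t]addrC.
  by rewrite -[1](divff t0) -mulrDl addrA -[t + t]mulr2n -mulr_natl two0 mul0r add0r.
(* The slopes m and frob m will differ by E + 1, and n and frob n by E; both must be nonzero. *)
have [e e0 e1] : exists2 e : K, e != 0 & e != 1.
  have /subsetPn [e _] : ~~ ([set: K] \subset [set 0; 1]).
    apply: contraL K2 => /subset_leq_card.
    by rewrite cardsT cards2 -leqNgt eq_sym oner_eq0.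
  by rewrite !inE negb_or => /andP[]; exists e.
pose E : L := e%:A; have fE : frob E = E by apply: frob_scalar.
have E0 : E != 0 by rewrite /E -in_algE fmorph_eq0.
have E1 : E + 1 != 0.
  by rewrite addr_eq0 oppE /E -in_algE fmorph_eq1.
pose v := w + E; have fv : frob v = v + 1 by rewrite frobD fw fE addrAC.
have nz (z : L) : frob z = z + 1 -> z != 0 /\ z + 1 != 0.
  move=> fz; rewrite -fz fmorph_eq0; suff: z != 0 by [].
  by apply: contra_eq_neq fz => ->; rewrite rmorph0 add0r eq_sym oner_neq0.
have [w0 w10] := nz w fw; have [v0 v10] := nz v fv.
have r0 : r != 0 by apply: contraNneq a0 => r0; rewrite -r2 r0 expr0n.
have fr0 : frob r != 0 by rewrite fmorph_eq0.
pose A := (r * frob r) ^+ 2; pose b' := b * (r * frob r).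
have A0 : A != 0 by rewrite expf_neq0 // mulf_neq0.
have fA : frob A = A by rewrite /A !frobE [_ * r]mulrC.
have fb' : frob b' = b' by rewrite /b' !(frob_b, frobE) [_ * r]mulrC.
(* After the substitution x = frob r * x', the form becomes
   A * Tr(x')^2 + b' * N(x') and (x', y) |-> (frob x', frob y) preserves the
   unital.  The configuration is invariant under it: the slopes are m, n and
   their conjugates, with n = m + w; [k] and [m] solve the remaining two
   equations, which are linear in them. *)
pose k := (w * (w + 1)) * (v * (v + 1)) / A.
have f11 (z : L) : z + 1 + 1 = z by rewrite -addrA -mulr2n two0 addr0.
have fw1 : frob (w + 1) = w by rewrite frobD fw rmorph1 f11.
have fv1 : frob (v + 1) = v by rewrite frobD fv rmorph1 f11.
have fk : frob k = k.
  rewrite /k !(fA, fw1, fv1, fw, fv, frobM, frobV).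
  by rewrite [(w + 1) * w]mulrC [(v + 1) * v]mulrC.
have k0 : k != 0 by rewrite !mulf_neq0 // invr_eq0.
pose m := k * (b' + A / (w * (w + 1))) + (E + 1) * w.
have fm : frob m = m + (E + 1).
  rewrite /m frobD !(fk, fA, fb', fE, fw1, fw, rmorph1, frobM, frobD, frobV).
  by rewrite [(w + 1) * w]mulrC [(E + 1) * (w + 1)]mulrDr mulr1 addrA.
have fn : frob (m + w) = m + v.
  by rewrite frobD fm fw /v -[RHS]f11; ring.
(* The condition after the substitution: slope s in the new coordinate is slope s / frob r in the
   old one, whence the division in the final witness. *)
pose h s z := A * (z + frob z) ^+ 2 + b' * (z * frob z) + (s * z + frob s * frob z).
have hE s z : G (frob r * z) + (s * z + frob (s * z)) = h s z.
  have -> : h s z = A * (z ^+ 2 + frob z ^+ 2) + b' * (z * frob z)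
      + (s * z + frob s * frob z) + 2 * (A * z * frob z) by rewrite /h; ring.
  by rewrite two0 mul0r addr0 /G /tnform -r2 !frobE /A /b'; ring.
have hfrob s z : h (frob s) (frob z) = h s z.
  by rewrite /h !frobK // [frob z + z]addrC [frob z * z]mulrC [frob s * _ + _]addrC.
have P1 : h m (k / w) = 0.
  (* [field] does not know that 2 = 0, so the expression is exhibited as 2 times an explicit
     cofactor. *)
  have -> : h m (k / w) = 2 * (k / (w * (w + 1))
      * (m + m * w + 2 * (v * (v + 1)) * (w ^+ 2 + w))).
    rewrite /h frobM frobV fk fw fm; move: fm; rewrite /m /k => _; field.
    by rewrite A0 w0 w10.
  by rewrite two0 mul0r.
have P2 : h m (k / v) = 0.
  have -> : h m (k / v) = 2 * (k / (v * (v + 1))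
      * (2 * (w * (w + 1)) * (v ^+ 2 + v) + w * (w + 1) + w * E + E ^+ 2 + E
         + (E + 1) * w + k * b' + m * v)).
    rewrite /h frobM frobV fk fv fm; move: v0 v10.
    rewrite /m /k /v => v0' v10'; field.
    by rewrite A0 w0 w10 v0' v10'.
  by rewrite two0 mul0r.
pose S := [:: m; frob m; m + w; frob (m + w)].
have uniq_S : uniq S.
  have d (z y : L) : y != 0 -> z != z + y.
    by move=> y0; rewrite -subr_eq0 opprD addNKr oppr_eq0.
  (* Separates frob m = m + (E + 1) from m + w and m + v: E + 1 is fixed by [frob], while w and v
     are not. *)
  have nE y : frob y = y + 1 -> E + 1 != y.
    move=> fy; apply: contra_eq_neq fy => <-.
    by rewrite frobD fE rmorph1 d // oner_neq0.
  rewrite /S fm fn /= !inE !negb_or !d //= !(inj_eq (addrI m)) !nE //=.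
  by rewrite d.
have ES z y : k / (z / frob r - y / frob r) = frob r * (k / (z - y)).
  by rewrite -mulrBl invfM invrK [_ * frob r]mulrC mulrCA.
have goalE z y : h z (k / (z - y)) = 0 ->
    let x := k / (z / frob r - y / frob r) in
    G x + (z / frob r * x + frob (z / frob r * x)) = 0.
  by move=> hz; rewrite /= ES [z / _ * _]mulrA divfK // hE.
have fkV z : k / frob z = frob (k / z) by rewrite frobM frobV fk.
exists (fun i => S`_i / frob r), k; split=> //.
- move=> i j /(mulIf (invr_neq0 fr0))/eqP.
  by rewrite nth_uniq // => /eqP/val_inj.
- by rewrite fk -mulr2n -mulr_natl two0 mul0r.
have mBw : m - (m + w) = w by rewrite opprD addNKr oppE.
have mBv : m - frob (m + w) = v by rewrite fn opprD addNKr oppE.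
case=> [[|[|//]] ?] [[|[|[|[|//]]]] ?] _ //= _; apply: goalE.
- by rewrite mBw.
- by rewrite mBv.
- by rewrite -[m + w]frobK // -rmorphB /= mBv fkV hfrob.
- by rewrite -rmorphB /= mBw fkV hfrob.
Qed.

End Configuration.

(** * The quadratic form of an elliptic cone *)

Lemma is_pointP (k : fieldType) (V : vectType k) (p : {vspace V}) :
  is_point p -> exists2 u, u != 0 & p = <[u]>%VS.
Proof.
rewrite /is_point => p1; have u0 : vpick p != 0.
  by rewrite vpick0 -dimv_eq0 p1.
exists (vpick p) => //; apply/esym/eqP.
by rewrite eqEdim -memvE memv_pick p1 dim_vline u0.
Qed.

(** [F] is the form of the base quadric composed with the projection [P] onto T from the vertex. A
    point of C is assumed because the cone over an empty base would be empty, although F v = 0. *)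
Lemma elliptic_cone_form (k : fieldType) (V : vectType k)
    (C : {vspace V} -> Prop) :
    \dim {:V} = 5%N -> elliptic_cone C -> (exists p, C p) ->
  exists (F : V -> k) (v : V), v != 0 /\
    [/\ quadratic_form F,
        forall u, F u = 0 -> (forall u', polar F u u' = 0) -> u \in <[v]>%VS,
        forall l, is_line l -> (forall u, u \in l -> F u = 0) -> v \in l
      & forall w, w != 0 -> (C <[w]>%VS <-> F w = 0)].
Proof.
move=> dimV [T [_ [E [[dimT [Q [qQ nsQ EP noline]]] /is_pointP[v v0 ->] vT CP]]]].
case=> p0 /CP[_ [e0 [Ee0 _]]].
have vT0 : (T :&: <[v]>)%VS = 0%VS.
  apply/eqP; rewrite -subv0; apply/subvP => u.
  rewrite memv_cap memv0 => /andP[uT /vlineP[c ec]]; rewrite ec.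
  have [->|c0] := eqVneq c 0; first by rewrite scale0r.
  case: vT; rewrite -memvE -[v]scale1r -(mulVf c0) -scalerA -ec.
  exact: memvZ.
have Tv0 : (<[v]> :&: T)%VS = 0%VS by rewrite capvC.
have full : (T + <[v]>)%VS = fullv.
  apply/eqP; rewrite eqEdim subvf dimv_disjoint_sum // dimT dimV.
  by rewrite dim_vline v0.
pose P := daddv_pi T <[v]>; pose P' := daddv_pi <[v]> T.
have PD u : u = P u + P' u by rewrite daddv_pi_add ?full ?memvf.
have PT u : P u \in T by apply: memv_pi.
have P'v u : P' u \in <[v]>%VS by apply: memv_pi.
have Pid u : u \in T -> P u = u by apply: daddv_pi_id.
have Pv0 u : u \in <[v]>%VS -> P u = 0.
  move=> uv; apply: (addIr u); rewrite add0r {3}[u]PD; congr (_ + _).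
  by rewrite /P' daddv_pi_id.
have Pker u : P u = 0 -> u \in <[v]>%VS by move=> e; rewrite [u]PD e add0r.
pose F u := Q (P u).
have polF u u' : polar F u u' = polar Q (P u) (P u') by rewrite /polar /F linearD.
exists F, v; split=> //; split.
- split=> [c u|c u u' w]; first by rewrite /F linearZ quadZ.
  by rewrite !polF linearP; case: qQ => _; apply.
- move=> u Fu Pu; apply/Pker/nsQ => // w wT.
  by rewrite -(Pid _ wT) -polF.
- move=> l l2 Fl; apply: contraT => vl; exfalso.
  (* A line missing the vertex projects injectively, onto a line contained in the elliptic
     quadric. *)
  have ker0 : (l :&: lker P)%VS = 0%VS.
    apply/eqP; rewrite -subv0; apply/subvP => u.
    rewrite memv_cap memv_ker memv0 => /andP[ul /eqP/Pker/vlineP[c ec]].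
    have [c0|c0] := eqVneq c 0; first by rewrite ec c0 scale0r.
    by case/negP: vl; rewrite -[v]scale1r -(mulVf c0) -scalerA -ec memvZ.
  have PlT : (P @: l <= T)%VS by apply/subvP => _ /memv_imgP[u _ ->].
  apply: (noline (P @: l)%VS) => //; first by rewrite /is_line limg_dim_eq.
  move=> p p1 pl; apply/EP; split=> //; first exact: subv_trans pl PlT.
  by move=> u /(subvP pl)/memv_imgP[u' u'l ->]; apply: Fl.
move=> w w0; rewrite CP; split=> [[_ [e [/EP[_ eT eQ] we]]]|Fw].
  move: we; rewrite -memvE => /memv_addP[x xv [y ye ->]].
  by rewrite /F linearD /= Pv0 // add0r Pid ?eQ //; apply: subvP ye.
split; first by rewrite /is_point dim_vline w0.
(* If w spans the vertex, any base point will do, here [e0]; otherwise the base point is the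
   projection of w. *)
have [Pw|Pw] := eqVneq (P w) 0.
  exists e0; split=> //; apply: subv_trans (addvSl _ _).
  by rewrite -memvE Pker.
exists <[P w]>%VS; split; last by rewrite -memvE {1}[w]PD addrC memv_add ?memv_line.
apply/EP; split; first by rewrite /is_point dim_vline Pw.
  by rewrite -memvE.
by move=> _ /vlineP[c ->]; rewrite quadZ // -/(F w) Fw mulr0.
Qed.

(** * The cone in coordinates where x = z = 0 is the spread line and [Psi 0 1 0] the vertex *)

Section ConeEquation.

Variables (K : finFieldType) (L : fieldExtType K).
Hypothesis dimL : \dim {:L} = 2%N.

Variables (W : vectType K) (F : W -> K) (Psi : L -> L -> K -> W).
Hypothesis qF : quadratic_form F.
Hypothesis PsiD : forall x y z x' y' z',
  Psi x y z + Psi x' y' z' = Psi (x + x') (y + y') (z + z').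
Hypothesis PsiZ : forall c x y z,
  c *: Psi x y z = Psi (c *: x) (c *: y) (c * z).
Hypothesis Psi_surj : forall w, exists x y z, w = Psi x y z.
Hypothesis Psi_inj : forall x y z x' y' z',
  Psi x y z = Psi x' y' z' -> [/\ x = x', y = y' & z = z'].
Hypothesis F_radical : forall u, F u = 0 -> (forall u', polar F u u' = 0) ->
  u \in <[(Psi 0 1 0)%R]>%VS.
Hypothesis F_infinity : forall x y, F (Psi x y 0) = 0 <-> x = 0.

(** F is expanded along x, y and z: it vanishes on the spread line, the x-y term is zero, and the
    terms mixed with z are K-linear functionals, hence traces. *)
Lemma cone_equation : exists a b eta eps gam : L,
  [/\ frob b = b, eps != 0, forall x, tnform a b x = 0 -> x = 0 &
      forall x y z, (F (Psi x y z))%:A = tnform a b x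
        + z%:A * (let t := eta * x + eps * y + gam * z%:A in t + frob t)].
Proof.
(* Otherwise a suitable multiple of y would give a zero of F at infinity off the spread line. *)
have polXY x y : polar F (Psi x 0 0) (Psi 0 y 0) = 0.
  have [->|x0] := eqVneq x 0.
    rewrite /polar PsiD !addr0 !add0r.
    by have h y' := (F_infinity 0 y').2 erefl; rewrite !h !subr0.
  apply/eqP; apply: contraT => p0; exfalso; move/eqP: x0; apply.
  pose c := - F (Psi x 0 0) / polar F (Psi x 0 0) (Psi 0 y 0).
  apply/(F_infinity x (c *: y)).
  have -> : Psi x (c *: y) 0 = Psi x 0 0 + c *: Psi 0 y 0.
    by rewrite PsiZ PsiD !scaler0 mulr0 !addr0 add0r.
  rewrite quadD quadZ // (F_infinity 0 y).2 // mulr0 addr0.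
  by rewrite polarC polarZl // polarC divfK // subrr.
have [a [b [fb gE]]] : exists a b, frob b = b /\
    forall x, (F (Psi x 0 0))%:A = tnform a b x.
  apply: (quadratic_form_trace_norm dimL (Q := fun x => F (Psi x 0 0))).
  have pE u v : polar (fun x => F (Psi x 0 0)) u v = polar F (Psi u 0 0) (Psi v 0 0).
    by rewrite /polar PsiD !addr0.
  split=> [c u|c u u' v]; first by rewrite -quadZ // PsiZ !scaler0 mulr0.
  rewrite !pE -(polarZl qF) -(polarDl qF) PsiZ PsiD.
  by rewrite !scaler0 mulr0 !addr0.
have [eta hE] : exists eta, forall x,
    (polar F (Psi x 0 0) (Psi 0 0 1))%:A = eta * x + frob (eta * x).
  apply: (linear_functional_trace dimL) => c u v.
  rewrite -(polarZl qF) -(polarDl qF) PsiZ PsiD.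
  by rewrite !scaler0 mulr0 !addr0.
have [eps pE] : exists eps, forall y,
    (polar F (Psi 0 y 0) (Psi 0 0 1))%:A = eps * y + frob (eps * y).
  apply: (linear_functional_trace dimL) => c u v.
  rewrite -(polarZl qF) -(polarDl qF) PsiZ PsiD.
  by rewrite !scaler0 mulr0 !addr0.
have [gam gamE] := trace_surj dimL (F (Psi 0 0 1)).
have PsiE x y z : Psi x y z = Psi x 0 0 + Psi 0 y 0 + z *: Psi 0 0 1.
  by rewrite PsiZ !PsiD !scaler0 mulr1 !addr0 !add0r.
exists a, b, eta, eps, gam; split=> //.
(* For eps = 0 the whole spread line would lie in the radical, which is only the vertex. *)
- apply/eqP => eps0; have [t /negP] := exists_nonscalar dimL; apply.
  have : Psi 0 t 0 \in <[(Psi 0 1 0)%R]>%VS.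
    apply: F_radical => [|u]; first exact/F_infinity.
    have [x [y [z ->]]] := Psi_surj u; rewrite [Psi x y z]PsiE polarC.
    rewrite !polarDl // polarZl //.
    rewrite polXY add0r [polar F (Psi 0 y 0) _]/polar PsiD !addr0.
    have h y' := (F_infinity 0 y').2 erefl; rewrite !h !subr0 add0r.
    apply/eqP; rewrite mulf_eq0; apply/orP; right.
    rewrite -(fmorph_eq0 (in_alg L)) /= polarC pE eps0 mul0r rmorph0.
    by rewrite addr0.
  move=> /vlineP[c]; rewrite PsiZ => /Psi_inj[_ -> _].
  by rewrite frob_scalar.
- by move=> x /eqP; rewrite -gE -in_algE fmorph_eq0 => /eqP/F_infinity.
move=> x y z; rewrite PsiE !quadD polXY quadZ // (F_infinity 0 y).2 // !addr0.
rewrite [polar F (_ + _) _]polarC polarZl //.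
rewrite [polar F (Psi 0 0 1) _]polarC polarDl //.
rewrite 2!algD algM algX gE -gamE algM algD hE pE /=.
by rewrite !(frobE dimL); ring.
Qed.

End ConeEquation.

(** * Matrices with prescribed rows *)

Section MatrixRows.

Variable k : fieldType.

Definition mx_rows (u v w : 'rV[k]_3) : 'M[k]_3 :=
  \matrix_(i < 3) [:: u; v; w]`_i.

Lemma vec3_mul_rows x y z u v w :
  vec3 x y z *m mx_rows u v w = x *: u + y *: v + z *: w.
Proof.
apply/rowP => j; rewrite !mxE !big_ord_recl big_ord0 !mxE /=.
by rewrite addr0 addrA.
Qed.

Lemma mx_rows_unit u v w :
    (forall x y z, x *: u + y *: v + z *: w = 0 -> [/\ x = 0, y = 0 & z = 0]) ->
  mx_rows u v w \in unitmx.
Proof.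
move=> inj; rewrite -row_free_unit; apply: inj_row_free => r.
have [x [y [z ->]]] := vec3_surj r.
by rewrite vec3_mul_rows => /inj[-> -> ->]; rewrite vec3_0.
Qed.

End MatrixRows.

(** * The equation of the unital in the plane *)

Section UnitalEquation.

Variables (K : finFieldType) (L : fieldExtType K).
Hypothesis dimL : \dim {:L} = 2%N.

(** All coordinate changes are L-linear, so they act on the plane and combine into [N]. The second
    clause says that (0 : 1 : 0) is the only point at infinity. *)
Lemma orthogonal_BM_unital_equation (U : {vspace 'rV[L]_3} -> Prop) :
    orthogonal_BM_unital U ->
  exists (N : 'M[L]_3) (a b : L),
    [/\ N \in unitmx, frob b = b, forall x, tnform a b x = 0 -> x = 0 &
      forall p, U p <-> is_point p /\ forall X Y,
        (vec3 X Y 1 *m N \in p -> tnform a b X + (Y + frob Y) = 0) /\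
        (vec3 X Y 0 *m N \in p -> X = 0)].
Proof.
case=> M [C [M_unit cone [s [/is_pointP[sg sg0 ->] s_inf CP]] UP]].
have bbE (w : bb_space L) : bb_map M w = vec3 w.1.1 w.1.2 w.2%:A *m M by [].
have dL : dim L = 2%N by rewrite -dimvf.
have dim5 : \dim {:bb_space L} = 5%N.
  by rewrite dimvf (erefl : dim (bb_space L) = (dim L + dim L + 1)%N) dL.
have [[[p r] z0] [/= z00 sgE]] := s_inf _ (memv_line sg).
have {s_inf} {}z00 : z0 = 0 by [].
move: sgE; rewrite {z0}z00 bbE /= scale0r => sgE.
(* The vectors of the spread line are the L-multiples of (p, r). *)
pose sv (z : L) : bb_space L := ((z * p, z * r), 0).
have pr0 (z : L) : z != 0 -> sv z != 0.
  move=> z0; apply: contraNneq sg0 => -[/eqP + /eqP].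
  rewrite !mulf_eq0 (negPf z0) /= => /eqP p0 /eqP r0.
  by rewrite sgE p0 r0 vec3_0 mul0mx.
have CPs (z : L) : z != 0 -> C <[sv z]>%VS.
  move=> z0; apply/CP; rewrite ?pr0 //; apply/vlineP; exists z.
  by rewrite bbE /= sgE scalemxAl vec3Z scale0r mulr0.
have [|F [v [v0 [qF radF lineF CF]]]] := elliptic_cone_form dim5 cone.
  by exists <[sv 1%R]>%VS; apply: CPs; apply: oner_neq0.
have Fs (z : L) : F (sv z) = 0.
  have [->|z0] := eqVneq z 0.
    by have -> : sv 0 = 0; [rewrite /sv !mul0r|apply: quad0].
  by apply/CF; [apply: pr0|apply: CPs].
(* The spread line, spanned over K by [sv 1] and [sv t], lies on the cone, so it contains the
   vertex. *)
have [z zv] : exists z, v = sv z.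
  have [t nt] := exists_nonscalar dimL.
  have svE (c d : K) : c *: sv 1 + d *: sv t = sv (c%:A + d%:A * t).
    congr ((_, _), _) => /=; last by rewrite !scaler0 addr0.
      by rewrite mul1r mulrDl -mulrA !mulr_algl.
    by rewrite mul1r mulrDl -mulrA !mulr_algl.
  have : v \in (<[sv 1%R]> + <[sv t]>)%VS.
    apply: lineF => [|u /memv_addP[_ /vlineP[c ->] [_ /vlineP[d ->] ->]]]; last first.
      by rewrite svE.
    rewrite /is_line dimv_disjoint_sum.
      rewrite !dim_vline !pr0 ?oner_neq0 //.
      by apply: contraNneq nt => ->; rewrite rmorph0.
    apply/eqP; rewrite -subv0; apply/subvP => u.
    rewrite memv_cap memv0 => /andP[/vlineP[c ->] /vlineP[d cd]]; rewrite cd.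
    have /eqP : sv (c%:A + (- d)%:A * t) = 0 by rewrite -svE cd scaleNr subrr.
    have [-> _|d0] := eqVneq d 0; first by rewrite scale0r.
    move/(contraTT (@pr0 _)); rewrite scaleNr mulNr subr_eq0 => /eqP ct.
    case/negP: nt; apply/frob_scalarP; exists (c / d).
    by rewrite mulrC -scalerA ct mulr_algl scalerA mulVf // scale1r.
  by case/memv_addP=> _ /vlineP[c ->] [_ /vlineP[d ->] ->]; rewrite svE; eexists.
have z0 : z != 0 by apply: contraNneq v0 => e; rewrite zv e /sv !mul0r.
pose pv := z * p; pose rv := z * r.
(* Completes (pv, rv) to an L-basis of L x L, so that the vertex becomes [Psi 0 1 0]. *)
have [p2 [r2 [basis_inj basis_surj]]] : exists p2 r2 : L,
    (forall x y, x * p2 + y * pv = 0 -> x * r2 + y * rv = 0 -> x = 0 /\ y = 0) /\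
    (forall X Y, exists x y, X = x * p2 + y * pv /\ Y = x * r2 + y * rv).
  have [pv0|pv0] := eqVneq pv 0.
    have rv0 : rv != 0.
      by apply: contraNneq v0 => e; rewrite zv /sv -/pv -/rv pv0 e.
    exists 1, 0; rewrite pv0; split=> [x y|X Y].
      rewrite mulr1 !mulr0 addr0 add0r => -> /eqP; rewrite mulf_eq0 (negPf rv0).
      by rewrite orbF => /eqP.
    by exists X, (Y / rv); rewrite mulr1 !mulr0 addr0 add0r divfK.
  exists 0, 1; split=> [x y|X Y].
    rewrite mulr0 add0r mulr1 => /eqP; rewrite mulf_eq0 (negPf pv0) orbF.
    by move/eqP->; rewrite mul0r addr0.
  exists (Y - X / pv * rv), (X / pv).
  by rewrite mulr0 add0r mulr1 subrK divfK.
pose Psi (x y : L) (c : K) : bb_space L :=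
  ((x * p2 + y * pv, x * r2 + y * rv), c).
have PsiD x y c x' y' c' :
    Psi x y c + Psi x' y' c' = Psi (x + x') (y + y') (c + c').
  by congr ((_, _), _) => /=; ring.
have PsiZ (d : K) x y c : d *: Psi x y c = Psi (d *: x) (d *: y) (d * c).
  by congr ((_, _), _) => /=; rewrite scalerDr !scalerAl.
have Psi0 x y c : Psi x y c = 0 -> [/\ x = 0, y = 0 & c = 0].
  by case=> e1 e2 ->; have [-> ->] := basis_inj x y e1 e2.
have Psi_inj x y c x' y' c' :
    Psi x y c = Psi x' y' c' -> [/\ x = x', y = y' & c = c'].
  move=> e; have /Psi0[] : Psi (x - x') (y - y') (c - c') = 0.
    have -> : Psi (x - x') (y - y') (c - c') = Psi x y c + -1 *: Psi x' y' c'.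
      by rewrite PsiZ PsiD !scaleN1r mulN1r.
    by rewrite e scaleN1r subrr.
  by do 3!move/subr0_eq->.
have Psi_surj w : exists x y c, w = Psi x y c.
  case: w => -[X Y] c; have [x [y [-> ->]]] := basis_surj X Y.
  by exists x, y, c.
have Psiv : Psi 0 1 0 = v by rewrite zv /Psi !mul0r !mul1r !add0r.
have F_inf x y : F (Psi x y 0) = 0 <-> x = 0.
  have [w0|w0] := eqVneq (Psi x y 0) 0.
    by rewrite w0 quad0 //; case: (Psi0 _ _ _ w0).
  rewrite -CF // CP //; split=> [/vlineP[c]|x0]; last first.
    apply/vlineP; exists (y * z); rewrite bbE sgE scalemxAl vec3Z /= x0 scale0r.
    by rewrite !mul0r !add0r mulr0 !mulrA.
  rewrite bbE sgE scalemxAl vec3Z => /(vec3_mulmx_inj M_unit)[/= e1 e2 _].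
  have [] // : [/\ x = 0, y = c / z & (0 : K) = 0].
  apply: Psi_inj; rewrite /Psi e1 e2 !mul0r !add0r /pv /rv.
  by rewrite !mulrA !divfK.
have [|a [b [eta [eps [gam [fb eps0 aniso FE]]]]]] :=
  cone_equation dimL qF PsiD PsiZ Psi_surj Psi_inj _ F_inf.
  by rewrite Psiv.
(* [A] is the change to that basis; [B] replaces y by eta x + eps y + gam z, the element whose trace
   is multiplied by z in the cone equation. *)
pose A := mx_rows (vec3 p2 r2 0) (vec3 pv rv 0) (vec3 0 0 1).
pose B := mx_rows (vec3 1 eta 0) (vec3 0 eps 0) (vec3 0 gam 1).
have AE x y c : vec3 x y c *m A = vec3 (x * p2 + y * pv) (x * r2 + y * rv) c.
  rewrite vec3_mul_rows !vec3Z !vec3D; congr vec3; ring.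
have BE x y c : vec3 x y c *m B = vec3 x (eta * x + eps * y + gam * c) c.
  rewrite vec3_mul_rows !vec3Z !vec3D; congr vec3; ring.
have A_unit : A \in unitmx.
  apply: mx_rows_unit => x y c; rewrite -vec3_mul_rows AE -vec3_0.
  by case/vec3_inj=> e1 e2 ->; have [-> ->] := basis_inj x y e1 e2.
have B_unit : B \in unitmx.
  apply: mx_rows_unit => x y c; rewrite -vec3_mul_rows BE -vec3_0.
  case/vec3_inj=> -> /[swap] ->; rewrite !mulr0 add0r addr0 => /eqP.
  by rewrite mulf_eq0 (negPf eps0) => /eqP.
pose N := invmx B *m A *m M.
have bbN x y c : bb_map M (Psi x y c)
    = vec3 x (eta * x + eps * y + gam * c%:A) c%:A *m N.
  by rewrite bbE -AE -BE /N !mulmxA mulmxK.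
exists N, a, b; split=> //.
  by rewrite !unitmx_mul unitmx_inv B_unit A_unit.
move=> q; rewrite UP; split=> -[q1 Uq]; split=> //.
  move=> X Y; split=> qXY.
    pose y := (Y - eta * X - gam) / eps.
    have YE : Y = eta * X + eps * y + gam * 1%:A.
      by rewrite scale1r /y; field.
    have w0 : Psi X y 1 != 0.
      by apply/eqP => /Psi0[_ _ /eqP]; rewrite oner_eq0.
    have /CF : C <[Psi X y 1%R]>%VS by apply: Uq; rewrite // bbN -YE scale1r.
    move=> /(_ w0) FXY; have := FE X y 1; rewrite FXY /= -YE !scale1r mul1r.
    by rewrite scale0r => <-.
  pose y := (Y - eta * X) / eps.
  have [/Psi0[] //|w0] := eqVneq (Psi X y 0) 0.
  apply/(F_inf X y)/CF => //; apply: Uq => //; rewrite bbN scale0r.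
  by have -> : eta * X + eps * y + gam * 0 = Y by rewrite /y; field.
(* Vectors at infinity are settled by [F_inf]; the others are scaled to last coordinate 1. *)
move=> w w0 wq; apply/CF => //; have [x [y [c wE]]] := Psi_surj w.
have [c0|c0] := eqVneq c 0.
  move: wq; rewrite wE c0 bbN scale0r => /(Uq _ _).2 ->; exact/F_inf.
have wE' : w = c *: Psi (c^-1 *: x) (c^-1 *: y) 1.
  by rewrite PsiZ !scalerA divff // !scale1r mulr1.
rewrite wE' quadZ //; apply/eqP; rewrite mulf_eq0 -(fmorph_eq0 (in_alg L)) /=.
rewrite -(fmorph_eq0 (in_alg L) (F _)) /= FE scale1r mul1r; apply/orP; right.
apply/eqP/(Uq _ _).1; move: wq; rewrite wE bbN => /(memvZ (c^-1%:A)).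
rewrite scalemxAl vec3Z !mulr1.
have cc : c^-1%:A * c%:A = 1 :> L by rewrite -algM mulVf // scale1r.
rewrite cc -[c^-1 *: x]mulr_algl -[c^-1 *: y]mulr_algl.
congr (is_true (vec3 _ _ _ *m N \in q)).
transitivity (eta * (c^-1%:A * x) + eps * (c^-1%:A * y)
  + gam * (c^-1%:A * c%:A)); first by ring.
by rewrite cc mulr1.
Qed.

(** * Hermitian matrices and the case a = 0 *)

Lemma conj_mxE (m n : nat) (A : 'M[L]_(m, n)) :
  conj_mx A = (map_mx (@frob K L) A)^T.
Proof. by []. Qed.

Lemma conj_mxM (m n l : nat) (A : 'M[L]_(m, n)) (B : 'M[L]_(n, l)) :
  conj_mx (A *m B) = conj_mx B *m conj_mx A.
Proof. by rewrite !conj_mxE map_mxM trmx_mul. Qed.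

Lemma conj_mxK (m n : nat) (A : 'M[L]_(m, n)) : conj_mx (conj_mx A) = A.
Proof. by apply/matrixP => i j; rewrite !mxE; apply: (frobK dimL). Qed.

(** The equation homogenizes to the Hermitian form b N(x) + Tr(y frob z), with Gram matrix [H0]; [H]
    is its transport by [N]. *)
Lemma classical_equation (U : {vspace 'rV[L]_3} -> Prop) (N : 'M[L]_3) (b : L) :
    N \in unitmx -> frob b = b -> b != 0 ->
    (forall p, U p <-> is_point p /\ forall X Y,
      (vec3 X Y 1 *m N \in p -> b * (X * frob X) + (Y + frob Y) = 0) /\
      (vec3 X Y 0 *m N \in p -> X = 0)) ->
  classical_unital U.
Proof.
move=> N_unit fb b0 UP.
pose H0 := mx_rows (vec3 b 0 0) (vec3 0 0 1) (vec3 0 1 0).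
have H0E x y z : vec3 x y z *m H0 = vec3 (x * b) z y.
  by rewrite vec3_mul_rows !vec3Z !vec3D; congr vec3; ring.
have H0_unit : H0 \in unitmx.
  apply: mx_rows_unit => x y z; rewrite -vec3_mul_rows H0E -vec3_0.
  by case/vec3_inj=> /eqP; rewrite mulf_eq0 (negPf b0) orbF => /eqP -> -> ->.
have H0_herm : conj_mx H0 = H0.
  rewrite conj_mxE; apply/matrixP => i j; rewrite !mxE.
  case: i => [[|[|[|//]]] ?]; case: j => [[|[|[|//]]] ?];
    by rewrite /= !mxE /= ?rmorph0 ?rmorph1 // fb.
pose form x y z := b * (x * frob x) + y * frob z + z * frob y.
have formE x y z : vec3 x y z *m H0 *m conj_mx (vec3 x y z) = (form x y z)%:M.
  apply/matrixP => i j; rewrite !ord1 H0E !mxE !big_ord_recl big_ord0 !mxE /= /form.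
  by rewrite /frob; ring.
pose H := invmx N *m H0 *m conj_mx (invmx N).
have HE x y z : (vec3 x y z *m N) *m H *m conj_mx (vec3 x y z *m N)
    = (form x y z)%:M.
  rewrite /H conj_mxM -!mulmxA [conj_mx (invmx N) *m _]mulmxA -conj_mxM mulmxV //.
  rewrite [N *m (_ *m _)]mulmxA mulmxV // mul1mx.
  have -> : conj_mx (1%:M : 'M[L]_3) = 1%:M by rewrite conj_mxE map_mx1 trmx1.
  by rewrite mul1mx mulmxA formE.
exists H; split.
  split; last by rewrite /H !conj_mxM conj_mxK H0_herm mulmxA.
  rewrite !unitmx_mul unitmx_inv N_unit H0_unit conj_mxE unitmx_tr map_unitmx.
  by rewrite unitmx_inv.
move=> p; rewrite UP; split=> -[p1 Up]; split=> //.
  (* One spanning vector suffices by sesquilinearity; for z != 0 its form value is N(z) times the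
     affine equation at (x / z, y / z). *)
  move=> u v; have [w w0 pE] := is_pointP p1.
  have [x [y [z wE]]] := vec3_coord N_unit w.
  have wp : vec3 x y z *m N \in p by rewrite pE wE memv_line.
  have f0 : form x y z = 0.
    have [z0|z0] := eqVneq z 0.
      move: wp; rewrite z0 => /(Up x y).2 ->.
      by rewrite /form rmorph0 !(mul0r, mulr0) !addr0.
    have fz0 : frob z != 0 by rewrite fmorph_eq0.
    have := memvZ z^-1 wp; rewrite scalemxAl vec3Z mulVf // => /(Up _ _).1.
    rewrite !frobM !frobV => e.
    have -> : form x y z = z * frob z * (b * (z^-1 * x * ((frob z)^-1 * frob x))
        + (z^-1 * y + (frob z)^-1 * frob y)) by rewrite /form; field; apply/andP.
    by rewrite e mulr0.
  rewrite pE wE => /vlineP[c ->] /vlineP[d ->].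
  have -> : conj_mx (d *: (vec3 x y z *m N)) = frob d *: conj_mx (vec3 x y z *m N).
    by rewrite !conj_mxE map_mxZ linearZ.
  by rewrite -scalemxAr -!scalemxAl HE f0 raddf0 !scaler0.
move=> X Y; split=> XYp; have := Up _ _ XYp XYp; rewrite HE => /matrixP/(_ 0 0).
  by rewrite !mxE eqxx mulr1n /form rmorph1 mulr1 mul1r addrA.
rewrite !mxE eqxx mulr1n /form rmorph0 mulr0 mul0r !addr0 => /eqP.
by rewrite mulf_eq0 (negPf b0) mulf_eq0 fmorph_eq0 orbb => /eqP.
Qed.

End UnitalEquation.

(** * From the equation and the slopes to the configuration *)

Theorem theorem3p1 (q : nat) (q_gt2 : (2 < q)%N)
  (K : finFieldType) (cardK : #|K| = q)
  (L : fieldExtType K) (dimL : \dim {:L} = 2%N)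
  (U : {vspace 'rV[L]_3} -> Prop)
  (U_BM : orthogonal_BM_unital U)
  (U_nonclassical : ~ classical_unital U) :
  exists l : 'I_4 -> {vspace 'rV[L]_3}, ONan_configuration U l.
Proof.
have [N [a [b [N_unit fb aniso UP]]]] := orthogonal_BM_unital_equation dimL U_BM.
(* If a = 0, anisotropy at 1 gives b != 0, and the unital is a Hermitian curve. *)
have a0 : a != 0.
  apply/eqP => a0; case: U_nonclassical.
  have GE x : tnform a b x = b * (x * frob x).
    by rewrite /tnform a0 mul0r rmorph0 !add0r.
  apply: (@classical_equation _ _ dimL U N b) => //.
    apply/eqP => b0; have /aniso/eqP : tnform a b 1 = 0 by rewrite GE b0 mul0r.
    by rewrite oner_eq0.
  move=> p; rewrite UP; split=> -[p1 Up]; split=> // X Y; move: (Up X Y);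
    by rewrite GE.
have UE x y : tnform a b x + (y + frob y) = 0 -> U (apoint N x y).
  move=> e; apply/UP; split=> [|X Y]; first exact: apoint_is_point.
  rewrite !mem_apoint // !mul1r !mul0r; split; first by case/andP=> /eqP-> /eqP->.
  by case/andP=> /eqP.
have G0 : tnform a b 0 = 0.
  by rewrite /tnform expr0n !mulr0 mul0r rmorph0 mulr0 !addr0.
have [s [c [s_inj c0 fc cP]]] :
    exists (s : 'I_4 -> L) c, [/\ injective s, c != 0, c + frob c = 0 &
      forall i j : 'I_4, (i < 2)%N -> (2 <= j)%N ->
        let x := c / (s i - s j) in
        tnform a b x + (s i * x + frob (s i * x)) = 0].
  have [two0|two0] := eqVneq (2 : L) 0; last exact: odd_configuration.
  by apply: even_configuration; rewrite // cardK.
apply: (two_pencils_ONan N_unit s_inj c0).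
- by apply: UE; rewrite G0 rmorph0 !addr0.
- by apply: UE; rewrite G0 fc addr0.
- by move=> i j i2 j2; apply/UE/cP.
Qed.
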